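(* Let $R$ be an associative ring with unit and let $M$ be a (left) $R$-module. Let $\mathcal M$ be the quasicoherent $\mathcal R$-module $\mathcal M(S)=S\otimes_R M$. Then the natural morphism of $\mathcal R$-modules $$\mathcal M\longrightarrow \mathcal M^{**}$$ is an isomorphism.
   Context: ''$R$-module'' means left $R$-module. An $R$-algebra is an associative unital ring $S$ together with a unital ring homomorphism $R\to S$ (the image is not assumed to be central); morphisms of $R$-algebras are ring homomorphisms compatible with the maps from $R$. A (left) $\mathcal R$-module is a covariant functor $\mathbb M$ from the category of $R$-algebras to abelian groups, together with a morphism of functors of sets $\mathcal R\times\mathbb M\to\mathbb M$ which makes $\mathbb M(S)$ a left $S$-module for every $R$-algebra $S$; here $\mathcal R(S):=S$. A morphism of $\mathcal R$-modules is a morphism of functors that is $S$-linear on $\mathbb M(S)$ for every $S$. Right $\mathcal R$-modules and their morphisms are defined in the same way, with right $S$-module structures. For an $R$-algebra $S$, the functor $\mathbb M_{|S}$ is the restriction of $\mathbb M$ to $S$-algebras, and is an $\mathcal S$-module, where $\mathcal S(T)=T$ for $S$-algebras $T$. The dual of an $\mathcal R$-module $\mathbb M$ is the right $\mathcal R$-module $\mathbb M^*$ with $\mathbb M^*(S):=\mathrm{Hom}_{\mathcal S}(\mathbb M_{|S},\mathcal S)$ (morphisms of $\mathcal S$-modules on the category of $S$-algebras), the right $S$-action being induced by right multiplication on $\mathcal S$. The dual of a right $\mathcal R$-module $\mathbb N$ is the left $\mathcal R$-module $\mathbb N^*$ with $\mathbb N^*(S):=\mathrm{Hom}_{\mathcal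 S}(\mathbb N_{|S},\mathcal S)$ (morphisms of right $\mathcal S$-modules), the left $S$-action being induced by left multiplication on $\mathcal S$. Only dual functors whose values are sets are considered. The natural morphism $\mathcal M\to\mathcal M^{**}$ is evaluation: for an $R$-algebra $S$, it sends $m\in\mathcal M(S)$ to the morphism $\tilde m\colon (\mathcal M^* )_{|S}\to\mathcal S$ with $\tilde m_T(w):=w_T(m_T)$ for every $S$-algebra $T$ and every $w\in\mathcal M^*(T)$, where $m_T$ is the image of $m$ in $\mathcal M(T)$. *)

(* Defs.v *)
From HB Require Import structures.
From mathcomp Require Import all_boot all_algebra ring_quotient boolp.
From mathcomp.multinomials Require Import freeg.
Set Implicit Arguments.
Unset Strict Implicit.
Unset Printing Implicit Defensive.
Import GRing.Theory.
Local Open Scope ring_scope.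
Local Open Scope quotient_scope.

(* The image of the structure map need not be central. *)
Record ralg (R : pzRingType) := Ralg {
  ralg_ring :> pzRingType;
  ralg_str : {rmorphism R -> ralg_ring} }.
Arguments Ralg {R ralg_ring} ralg_str.
Arguments ralg_str {R} r.

Record ralg_hom (R : pzRingType) (S T : ralg R) := RalgHom {
  ralg_map :> {rmorphism S -> T};
  ralg_map_str : forall r : R, ralg_map (ralg_str S r) = ralg_str T r }.
Arguments RalgHom {R S T} ralg_map ralg_map_str.

Definition id_hom (R : pzRingType) (S : ralg R) : ralg_hom S S :=
  @RalgHom R S S idfun (fun=> erefl).

Lemma comp_hom_str (R : pzRingType) (S T U : ralg R)
  (g : ralg_hom T U) (f : ralg_hom S T) (r : R) :
  (g \o f) (ralg_str S r) = ralg_str U r.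
Proof. by rewrite /= !ralg_map_str. Qed.

Definition comp_hom (R : pzRingType) (S T U : ralg R)
    (g : ralg_hom T U) (f : ralg_hom S T) : ralg_hom S U :=
  @RalgHom R S U (g \o f) (comp_hom_str g f).

Lemma ralg_hom_eq (R : pzRingType) (S T : ralg R) (f g : ralg_hom S T) :
  f =1 g -> f = g.
Proof.
case: f g => [[f [[f1] [f2]]] fP] [[g [[g1] [g2]]] gP] /= /funext fg.
subst g; rewrite (Prop_irrelevance f1 g1) (Prop_irrelevance f2 g2) in fP *.
by rewrite (Prop_irrelevance fP gP).
Qed.

(* An S-algebra T is an R-algebra by restriction along the structure map of S. *)
Definition res (R : pzRingType) (S : ralg R) (T : ralg S) : ralg R :=
  @Ralg R T (ralg_str T \o ralg_str S).

Lemma res_hom_str (R : pzRingType) (S : ralg R) (T U : ralg S)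
  (f : ralg_hom T U) (r : R) : f (ralg_str (res T) r) = ralg_str (res U) r.
Proof. exact: ralg_map_str. Qed.

Definition res_hom (R : pzRingType) (S : ralg R) (T U : ralg S)
    (f : ralg_hom T U) : ralg_hom (res T) (res U) :=
  @RalgHom R (res T) (res U) f (res_hom_str f).

(* Along h : S -> S', an S'-algebra T is also an S-algebra. *)
Definition pull (R : pzRingType) (S S' : ralg R) (h : ralg_hom S S')
    (T : ralg S') : ralg S :=
  @Ralg S T (ralg_str T \o h).

Lemma pull_hom_str (R : pzRingType) (S S' : ralg R) (h : ralg_hom S S')
  (T U : ralg S') (f : ralg_hom T U) (s : S) :
  f (ralg_str (pull h T) s) = ralg_str (pull h U) s.
Proof. exact: ralg_map_str. Qed.

Definition pull_hom (R : pzRingType) (S S' : ralg R) (h : ralg_hom S S')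
    (T U : ralg S') (f : ralg_hom T U) : ralg_hom (pull h T) (pull h U) :=
  @RalgHom S (pull h T) (pull h U) f (pull_hom_str h f).

Lemma pull_id_str (R : pzRingType) (S S' : ralg R) (h : ralg_hom S S')
  (T : ralg S') (r : R) :
  idfun (ralg_str (res T) r) = ralg_str (res (pull h T)) r.
Proof. by rewrite /= ralg_map_str. Qed.

(* [res T] and [res (pull h T)] are the same ring with structure maps that are
   equal but not convertible; the identity is an isomorphism between them. *)
Definition pull_id (R : pzRingType) (S S' : ralg R) (h : ralg_hom S S')
    (T : ralg S') : ralg_hom (res T) (res (pull h T)) :=
  @RalgHom R (res T) (res (pull h T)) idfun (pull_id_str h T).

Definition self_alg (S : pzRingType) : ralg S := @Ralg S S idfun.

Definition to_self (R : pzRingType) (S : ralg R) (T : ralg S) :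
    ralg_hom S (res (self_alg (res T) : ralg (res T))) :=
  @RalgHom R S (res (self_alg (res T) : ralg (res T))) (ralg_str T) (fun=> erefl).

Inductive side := Left | Right.

Definition flip (sd : side) : side :=
  match sd with Left => Right | Right => Left end.

(* Left or right modules over A.  lmodType cannot be used for the values of a dual
   functor: an element of a dual is a family indexed by all algebras, so duals live
   in a larger universe than the carriers of rings and of lmodType. *)
Record smod (sd : side) (A : pzRingType) := Smod {
  smod_car :> Type;
  szero : smod_car;
  sopp : smod_car -> smod_car;
  sadd : smod_car -> smod_car -> smod_car;
  sact : A -> smod_car -> smod_car;
  saddA : associative sadd;
  saddC : commutative sadd;
  sadd0 : left_id szero sadd;
  saddN : left_inverse szero sopp sadd;
  sactDr : forall a, {morph sact a : x y / sadd x y};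
  sactDl : forall a b x, sact (a + b) x = sadd (sact a x) (sact b x);
  sact1 : forall x, sact 1 x = x;
  sactM : forall a b x, sact (a * b) x =
    match sd with
    | Left => sact a (sact b x)
    | Right => sact b (sact a x)
    end }.
Arguments szero {sd A s}.
Arguments sopp {sd A s}.
Arguments sadd {sd A s}.
Arguments sact {sd A s}.

(* [side_mul sd a x] is the action of a on x in A regarded as a left or right
   module over itself. *)
Definition side_mul (sd : side) (A : pzRingType) (a x : A) : A :=
  match sd with Left => a * x | Right => x * a end.

Section SideMul.
Variables (sd : side) (A : pzRingType).
Implicit Types a b x y : A.

Lemma side_mulDr a : {morph side_mul sd a : x y / x + y}.
Proof. by case: sd => x y; rewrite /= ?mulrDr ?mulrDl. Qed.

Lemma side_mulDl a b x : side_mul sd (a + b) x = side_mul sd a x + side_mul sd b x.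
Proof. by case: sd; rewrite /= ?mulrDr ?mulrDl. Qed.

Lemma side_mul1 x : side_mul sd 1 x = x.
Proof. by case: sd; rewrite /= ?mulr1 ?mul1r. Qed.

Lemma side_mulM a b x : side_mul sd (a * b) x =
  match sd with
  | Left => side_mul sd a (side_mul sd b x)
  | Right => side_mul sd b (side_mul sd a x)
  end.
Proof. by case: sd; rewrite /= mulrA. Qed.

Lemma side_mulC a b x :
  side_mul (flip sd) a (side_mul sd b x) = side_mul sd b (side_mul (flip sd) a x).
Proof. by case: sd; rewrite /= mulrA. Qed.

Lemma side_mul0 a : side_mul sd a 0 = 0.
Proof. by case: sd; rewrite /= ?mulr0 ?mul0r. Qed.

Lemma side_mulN a x : side_mul sd a (- x) = - side_mul sd a x.
Proof. by case: sd; rewrite /= ?mulrN ?mulNr. Qed.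

Lemma rmorph_side_mul (B : pzRingType) (f : {rmorphism A -> B}) a x :
  f (side_mul sd a x) = side_mul sd (f a) (f x).
Proof. by case: sd; rewrite /= rmorphM. Qed.

Definition smod_self : smod sd A :=
  @Smod sd A A 0 -%R +%R (@side_mul sd A) (@addrA A) (@addrC A) (@add0r A)
    (@addNr A) side_mulDr side_mulDl side_mul1 side_mulM.

End SideMul.

(* A left (sd = Left) or right (sd = Right) module over the functor S |-> S on
   R-algebras: a functor to abelian groups with a compatible functorial action. *)
Record fmod (sd : side) (R : pzRingType) := Fmod {
  fmod_obj :> forall S : ralg R, smod sd S;
  fmap : forall S T : ralg R, ralg_hom S T -> fmod_obj S -> fmod_obj T;
  fmapD : forall (S T : ralg R) (f : ralg_hom S T), {morph fmap f : x y / sadd x y};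
  fmapZ : forall (S T : ralg R) (f : ralg_hom S T) (a : S) (x : fmod_obj S),
    fmap f (sact a x) = sact (f a) (fmap f x);
  fmap_id : forall (S : ralg R) (x : fmod_obj S), fmap (id_hom S) x = x;
  fmap_comp : forall (S T U : ralg R) (g : ralg_hom T U) (f : ralg_hom S T)
    (x : fmod_obj S), fmap (comp_hom g f) x = fmap g (fmap f x) }.
Arguments fmap {sd R} _ {S T} _ _.

Lemma fmap_ext (sd : side) (R : pzRingType) (M : fmod sd R) (S T : ralg R)
  (f g : ralg_hom S T) (x : M S) : f =1 g -> fmap M f x = fmap M g x.
Proof. by move=> /ralg_hom_eq ->. Qed.

Record fhom (sd : side) (R : pzRingType) (M N : fmod sd R) := Fhom {
  fhom_app :> forall S : ralg R, M S -> N S;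
  fhomD : forall S : ralg R, {morph @fhom_app S : x y / sadd x y};
  fhomZ : forall (S : ralg R) (a : S) (x : M S),
    @fhom_app S (sact a x) = sact a (@fhom_app S x);
  fhom_nat : forall (S T : ralg R) (f : ralg_hom S T) (x : M S),
    @fhom_app T (fmap M f x) = fmap N f (@fhom_app S x) }.
Arguments fhom_app {sd R M N} _ S _.

Lemma fhom_eq (sd : side) (R : pzRingType) (M N : fmod sd R) (f g : fhom M N) :
  (forall (S : ralg R) (x : M S), f S x = g S x) -> f = g.
Proof.
case: f g => [f fD fZ fN] [g gD gZ gN] /= fg.
have {}fg : f = g.
  by apply: functional_extensionality_dep => S; apply: functional_extensionality_dep.
subst g; rewrite (Prop_irrelevance fD gD) (Prop_irrelevance fZ gZ).
by rewrite (Prop_irrelevance fN gN).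
Qed.

Definition fhom_id (sd : side) (R : pzRingType) (M : fmod sd R) : fhom M M :=
  @Fhom sd R M M (fun S x => x) (fun S x y => erefl) (fun S a x => erefl)
    (fun S T f x => erefl).

Section FhomComp.
Variables (sd : side) (R : pzRingType) (M N P : fmod sd R).
Variables (g : fhom N P) (f : fhom M N).

Definition fhom_comp : fhom M P.
Proof.
refine (@Fhom sd R M P (fun S x => g S (f S x)) _ _ _).
- by move=> S x y; rewrite !fhomD.
- by move=> S a x; rewrite !fhomZ.
- by move=> S T h x; rewrite !fhom_nat.
Defined.

End FhomComp.

Definition is_iso (sd : side) (R : pzRingType) (M N : fmod sd R) (f : fhom M N) : Prop :=
  exists g : fhom N M, fhom_comp g f = fhom_id M /\ fhom_comp f g = fhom_id N.

(* The functor S |-> S. *)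
Definition fmod_self (sd : side) (R : pzRingType) : fmod sd R.
Proof.
refine (@Fmod sd R (fun S => smod_self sd S) (fun S T f => f) _ _ _ _) => //=.
- by move=> S T f x y; rewrite /= rmorphD.
- by move=> S T f a x; rewrite /= rmorph_side_mul.
Defined.

(* The restriction of M to S-algebras. *)
Definition restr (sd : side) (R : pzRingType) (M : fmod sd R) (S : ralg R) : fmod sd S.
Proof.
refine (@Fmod sd S (fun T => M (res T)) (fun T U f => fmap M (res_hom f)) _ _ _ _).
- by move=> T U f x y; rewrite fmapD.
- by move=> T U f a x; rewrite fmapZ.
- move=> T x; rewrite -[RHS](fmap_id x).
  exact: fmap_ext.
- move=> T U V g f x; rewrite -fmap_comp.
  exact: fmap_ext.
Defined.

Lemma restr_fhom_ext (sd : side) (R : pzRingType) (M : fmod sd R) (S : ralg R)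
  (w : fhom (restr M S) (fmod_self sd S)) (T : ralg S) (U : ralg R)
  (f g : ralg_hom U (res T)) (x : M U) :
  f =1 g -> w T (fmap M f x) = w T (fmap M g x) :> T.
Proof. by move=> /ralg_hom_eq ->. Qed.
Arguments restr_fhom_ext {sd R M S} w T {U f g x}.

Section Dual.
Variables (sd : side) (R : pzRingType) (M : fmod sd R).

Section Values.
Variable S : ralg R.
Local Notation Hom := (fhom (restr M S) (fmod_self sd S)).

Definition dual_zero : Hom.
Proof.
refine (@Fhom _ _ (restr M S) (fmod_self sd S) (fun T _ => 0) _ _ _).
- by move=> T x y /=; rewrite addr0.
- by move=> T a x; rewrite /= side_mul0.
- by move=> T U f x /=; rewrite rmorph0.
Defined.

Definition dual_opp (w : Hom) : Hom.
Proof.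
refine (@Fhom _ _ (restr M S) (fmod_self sd S) (fun T x => - w T x) _ _ _).
- by move=> T x y; rewrite fhomD /= opprD.
- by move=> T a x; rewrite fhomZ /= side_mulN.
- by move=> T U f x; rewrite fhom_nat /= rmorphN.
Defined.

Definition dual_add (w v : Hom) : Hom.
Proof.
refine (@Fhom _ _ (restr M S) (fmod_self sd S) (fun T x => w T x + v T x) _ _ _).
- by move=> T x y; rewrite !fhomD /= addrACA.
- by move=> T a x; rewrite !fhomZ /= side_mulDr.
- by move=> T U f x; rewrite !fhom_nat /= rmorphD.
Defined.

(* For sd = Left this is the right action (w a)_T(x) = w_T(x) a, for sd = Right the
   left action (a w)_T(x) = a w_T(x). *)
Definition dual_act (a : S) (w : Hom) : Hom.
Proof.
refine (@Fhom _ _ (restr M S) (fmod_self sd S)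
  (fun T x => side_mul (flip sd) (ralg_str T a) (w T x)) _ _ _).
- by move=> T x y; rewrite fhomD /= side_mulDr.
- by move=> T b x; rewrite fhomZ /= side_mulC.
- move=> T U f x; rewrite fhom_nat /= -(ralg_map_str f).
  by rewrite rmorph_side_mul.
Defined.

Definition dual_obj : smod (flip sd) S.
Proof.
refine (@Smod (flip sd) S Hom dual_zero dual_opp dual_add dual_act _ _ _ _ _ _ _ _).
- by move=> u v w; apply: fhom_eq => T x /=; rewrite addrA.
- by move=> u v; apply: fhom_eq => T x /=; rewrite addrC.
- by move=> u; apply: fhom_eq => T x /=; rewrite add0r.
- by move=> u; apply: fhom_eq => T x /=; rewrite addNr.
- by move=> a u v; apply: fhom_eq => T x /=; rewrite side_mulDr.
- by move=> a b u; apply: fhom_eq => T x /=; rewrite rmorphD side_mulDl.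
- by move=> u; apply: fhom_eq => T x /=; rewrite rmorph1 side_mul1.
- move=> a b u; case E: (flip sd); apply: fhom_eq => T x /=;
  by rewrite rmorphM side_mulM E.
Defined.

End Values.

Definition dual_fmap (S S' : ralg R) (h : ralg_hom S S') (w : dual_obj S) : dual_obj S'.
Proof.
refine (@Fhom sd S' (restr M S') (fmod_self sd S')
  (fun T x => w (pull h T) (fmap M (pull_id h T) x)) _ _ _).
- by move=> T x y; rewrite fmapD fhomD.
- by move=> T a x; rewrite fmapZ fhomZ.
- move=> T U f x /=.
  have := fhom_nat w (pull_hom h f) (fmap M (pull_id h T) x).
  rewrite /= => <-; rewrite -!fmap_comp.
  exact: (restr_fhom_ext w (pull h U)).
Defined.

Lemma dual_id_str (S : ralg R) (T : ralg S) (s : S) :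
  idfun (ralg_str (pull (id_hom S) T) s) = ralg_str T s.
Proof. by []. Qed.

Lemma dual_comp_str (S S' S'' : ralg R) (g : ralg_hom S' S'') (f : ralg_hom S S')
  (T : ralg S'') (s : S) :
  idfun (ralg_str (pull (comp_hom g f) T) s) = ralg_str (pull f (pull g T)) s.
Proof. by []. Qed.

Definition dual : fmod (flip sd) R.
Proof.
refine (@Fmod (flip sd) R dual_obj dual_fmap _ _ _ _).
- by move=> S T f u v; apply: fhom_eq.
- move=> S T f a u; apply: fhom_eq => U x //=.
- move=> S w; apply: fhom_eq => T x /=.
  have := fhom_nat w (@RalgHom S (pull (id_hom S) T) T idfun (@dual_id_str S T))
    (fmap M (pull_id (id_hom S) T) x).
  rewrite /= => <-; rewrite -fmap_comp -[in RHS](fmap_id x).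
  exact: (restr_fhom_ext w T).
- move=> S S' S'' g f w; apply: fhom_eq => T x /=.
  have := fhom_nat w (@RalgHom S (pull (comp_hom g f) T) (pull f (pull g T)) idfun
    (@dual_comp_str _ _ _ g f T)) (fmap M (pull_id (comp_hom g f) T) x).
  rewrite /= => <-; rewrite -!fmap_comp.
  exact: (restr_fhom_ext w (pull f (pull g T))).
Defined.

End Dual.

Section Bidual.
Variables (R : pzRingType) (M : fmod Left R).

(* For an S-algebra T, the module M* restricted to S has at T the value
   M*(res T), so that w : M*(res T) is evaluated at [res T] as an algebra over
   itself, on the image of m. *)
Definition bidual_app (S : ralg R) (m : M S) : dual (dual M) S.
Proof.
refine (@Fhom Right S (restr (dual M) S) (fmod_self Right S)
  (fun T w => w (self_alg (res T)) (fmap M (to_self T) m)) _ _ _).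
- by [].
- by [].
- move=> T U f w /=.
  have fP s : f (ralg_str (self_alg (res T)) s)
      = ralg_str (pull (res_hom f) (self_alg (res U))) s by [].
  have := fhom_nat w (@RalgHom (res T) (self_alg (res T))
    (pull (res_hom f) (self_alg (res U))) f fP) (fmap M (to_self T) m).
  rewrite /= => <-; rewrite -!fmap_comp; apply: (restr_fhom_ext w (pull (res_hom f) (self_alg (res U)))).
  by move=> s /=; rewrite ralg_map_str.
Defined.

Definition bidual_eval : fhom M (dual (dual M)).
Proof.
refine (@Fhom Left R M (dual (dual M)) bidual_app _ _ _).
- by move=> S x y; apply: fhom_eq => T w /=; rewrite fmapD fhomD.
- by move=> S a x; apply: fhom_eq => T w /=; rewrite fmapZ fhomZ.
- move=> S S' h x; apply: fhom_eq => T w /=.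
  set U := pull (pull_id h T) (self_alg (res (pull h T))).
  have idP (t : T) : idfun (ralg_str (self_alg (res T)) t) = ralg_str U t by [].
  have := fhom_nat w (@RalgHom (res T) (self_alg (res T)) U idfun idP)
    (fmap M (to_self T) (fmap M h x)).
  rewrite /= => <-; rewrite -!fmap_comp.
  exact: (restr_fhom_ext w U).
Defined.

End Bidual.
Section Tensor.
Variables (R : pzRingType) (M : lmodType R).

Section Values.
Variable S : ralg R.
Local Notation free := {freeg (S * M)}.

Inductive tens_null : free -> Prop :=
| tens_null0 : tens_null 0
| tens_nullB x y : tens_null x -> tens_null y -> tens_null (x - y)
| tens_nullDl s s' m : tens_null (<< (s + s', m) >> - << (s, m) >> - << (s', m) >>)
| tens_nullDr s m m' : tens_null (<< (s, m + m') >> - << (s, m) >> - << (s, m') >>)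
| tens_nullZ s r m :
    tens_null (<< (s * ralg_str S r, m) >> - << (s, r *: m) >>).

Definition tens_ker : {pred free} := fun x => `[< tens_null x >].

Lemma tens_ker_zmod : zmod_closed tens_ker.
Proof.
split; first by apply/asboolP/tens_null0.
by move=> x y /asboolP xP /asboolP yP; apply/asboolP/tens_nullB.
Qed.

HB.instance Definition _ := GRing.isZmodClosed.Build free tens_ker tens_ker_zmod.

(* S \otimes_R M is the free abelian group on S * M modulo the subgroup generated
   by the usual relations. *)
Definition tens : zmodType := Quotient.quot tens_ker.

Definition tens_pi (x : free) : tens := \pi_(Quotient.quot tens_ker) x.

Lemma tens_piB : {morph tens_pi : x y / x - y}.
Proof. exact: (raddfB \pi_(Quotient.quot tens_ker)). Qed.

Lemma tens_pi0 : tens_pi 0 = 0.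
Proof. exact: (raddf0 \pi_(Quotient.quot tens_ker)). Qed.

Lemma tens_pi0P (x : free) : reflect (tens_null x) (tens_pi x == 0).
Proof.
rewrite -tens_pi0 -Quotient.idealrBE subr0.
exact: asboolP.
Qed.

Definition tmul (s : S) (m : M) : tens := tens_pi << (s, m) >>.

Lemma tmulDl s s' m : tmul (s + s') m = tmul s m + tmul s' m.
Proof.
apply/eqP; rewrite -subr_eq0 opprD addrA -!tens_piB.
exact/tens_pi0P/tens_nullDl.
Qed.

Lemma tmulDr s m m' : tmul s (m + m') = tmul s m + tmul s m'.
Proof.
apply/eqP; rewrite -subr_eq0 opprD addrA -!tens_piB.
exact/tens_pi0P/tens_nullDr.
Qed.

Lemma tmulZ s r m : tmul (s * ralg_str S r) m = tmul s (r *: m).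
Proof.
apply/eqP; rewrite -subr_eq0 -tens_piB.
exact/tens_pi0P/tens_nullZ.
Qed.

Lemma tens_ind (P : tens -> Prop) : P 0 -> (forall x y, P x -> P y -> P (x - y)) ->
  (forall s m, P (tmul s m)) -> forall x, P x.
Proof.
move=> P0 PB Pt x.
have PN y : P y -> P (- y) by move=> ?; rewrite -sub0r; apply: PB.
have PD y z : P y -> P z -> P (y + z).
  by move=> ? /PN ?; rewrite -[z]opprK; apply: PB.
have PMn y n : P y -> P (y *+ n).
  by move=> Py; elim: n => [|n IHn]; rewrite ?mulr0n // mulrS; apply: PD.
rewrite -[x]reprK -(freeg_sumE (repr x)).
rewrite (raddf_sum \pi_(Quotient.quot tens_ker)).
apply: (big_ind P) => // -[s m] _; set k := coeff _ _.
have -> : << k *g (s, m) >> = << (s, m) >> *~ k :> free.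
  by rewrite freeg_mulz intz.
rewrite (raddfMz \pi_(Quotient.quot tens_ker)).
by case: k => n; [apply: PMn; apply: Pt | apply/PN/PMn/Pt].
Qed.

Lemma tens_ext (V : zmodType) (f g : tens -> V) :
  {morph f : x y / x - y} -> {morph g : x y / x - y} ->
  (forall s m, f (tmul s m) = g (tmul s m)) -> f =1 g.
Proof.
move=> fB gB fg; have f0 : f 0 = g 0 by rewrite -(subrr 0) fB gB !subrr.
by elim/tens_ind => // x y fx fy; rewrite fB gB fx fy.
Qed.

Section Lift.
Variables (V : zmodType) (f : S -> M -> V).
Hypothesis fDl : forall s s' m, f (s + s') m = f s m + f s' m.
Hypothesis fDr : forall s m m', f s (m + m') = f s m + f s m'.
Hypothesis fZ : forall s r m, f (s * ralg_str S r) m = f s (r *: m).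

Definition tens_lift_free (x : free) : V :=
  fglift (fun p : S * M => f p.1 p.2 : zmodule V) x.

Lemma tens_lift_freeB : {morph tens_lift_free : x y / x - y}.
Proof. exact: (lift_is_additive (fun p : S * M => f p.1 p.2 : zmodule V)). Qed.

Lemma tens_lift_freeE s m : tens_lift_free << (s, m) >> = f s m.
Proof. by rewrite /tens_lift_free liftU scale1r. Qed.

Lemma tens_lift_null x : tens_null x -> tens_lift_free x = 0.
Proof.
elim=> [|y z _ Hy _ Hz|s s' m|s m m'|s r m];
  rewrite ?tens_lift_freeB ?tens_lift_freeE.
- by rewrite -(subrr (0 : free)) tens_lift_freeB subrr.
- by rewrite Hy Hz subrr.
- by rewrite fDl -addrA -opprD subrr.
- by rewrite fDr -addrA -opprD subrr.
- by rewrite fZ subrr.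
Qed.

Definition tens_lift (x : tens) : V := tens_lift_free (repr x).

Lemma tens_lift_pi x : tens_lift (tens_pi x) = tens_lift_free x.
Proof.
apply/eqP; rewrite -subr_eq0 -tens_lift_freeB; apply/eqP/tens_lift_null.
by apply/tens_pi0P; rewrite tens_piB subr_eq0 /tens_pi reprK.
Qed.

Lemma tens_liftE s m : tens_lift (tmul s m) = f s m.
Proof. by rewrite tens_lift_pi tens_lift_freeE. Qed.

Lemma tens_liftB : {morph tens_lift : x y / x - y}.
Proof.
move=> x y; rewrite -[x]reprK -[y]reprK -/(tens_pi _) -/(tens_pi _) -tens_piB.
by rewrite !tens_lift_pi tens_lift_freeB.
Qed.

End Lift.

Lemma tmul_actDl a s s' m : tmul (a * (s + s')) m = tmul (a * s) m + tmul (a * s') m.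
Proof. by rewrite mulrDr tmulDl. Qed.

Lemma tmul_actZ a s r m : tmul (a * (s * ralg_str S r)) m = tmul (a * s) (r *: m).
Proof. by rewrite mulrA tmulZ. Qed.

(* a (s \otimes m) = (a s) \otimes m *)
Definition tens_act (a : S) : tens -> tens := tens_lift (fun s m => tmul (a * s) m).

Lemma tens_actE a s m : tens_act a (tmul s m) = tmul (a * s) m.
Proof.
exact: (tens_liftE (tmul_actDl a) (fun s m m' => tmulDr _ m m') (tmul_actZ a)).
Qed.

Lemma tens_actB a : {morph tens_act a : x y / x - y}.
Proof.
exact: (tens_liftB (tmul_actDl a) (fun s m m' => tmulDr _ m m') (tmul_actZ a)).
Qed.

Lemma tens_actD a : {morph tens_act a : x y / x + y}.
Proof.
move=> x y; have N z : tens_act a (- z) = - tens_act a z.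
  by rewrite -[- z]sub0r tens_actB -{1}(subrr 0) tens_actB subrr sub0r.
by rewrite -{1}[y]opprK tens_actB N opprK.
Qed.

Definition tens_smod : smod Left S.
Proof.
refine (@Smod Left S tens 0 -%R +%R tens_act (@addrA _) (@addrC _) (@add0r _)
  (@addNr _) tens_actD _ _ _).
- move=> a b; apply: tens_ext => [|x y|s m]; first exact: tens_actB.
    by rewrite !tens_actB opprD addrACA.
  by rewrite !tens_actE mulrDl tmulDl.
- apply: tens_ext => [|//|s m]; first exact: tens_actB.
  by rewrite tens_actE mul1r.
- move=> a b; apply: tens_ext => [|x y|s m]; first exact: tens_actB.
    by rewrite !tens_actB.
  by rewrite !tens_actE mulrA.
Defined.

End Values.

Section Map.
Variables (S T : ralg R) (f : ralg_hom S T).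

(* s \otimes m |-> f s \otimes m *)
Definition tens_map : tens S -> tens T := tens_lift (fun s m => tmul (f s) m).

Lemma tmul_mapDl s s' m : tmul (f (s + s')) m = tmul (f s) m + tmul (f s') m.
Proof. by rewrite rmorphD tmulDl. Qed.

Lemma tmul_mapZ s r m : tmul (f (s * ralg_str S r)) m = tmul (f s) (r *: m).
Proof. by rewrite rmorphM ralg_map_str tmulZ. Qed.

Lemma tens_mapE s m : tens_map (tmul s m) = tmul (f s) m.
Proof.
exact: (tens_liftE tmul_mapDl (fun s m m' => tmulDr _ m m') tmul_mapZ).
Qed.

Lemma tens_mapB : {morph tens_map : x y / x - y}.
Proof.
exact: (tens_liftB tmul_mapDl (fun s m m' => tmulDr _ m m') tmul_mapZ).
Qed.

Lemma tens_mapD : {morph tens_map : x y / x + y}.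
Proof.
move=> x y; have N z : tens_map (- z) = - tens_map z.
  by rewrite -[- z]sub0r tens_mapB -{1}(subrr 0) tens_mapB subrr sub0r.
by rewrite -{1}[y]opprK tens_mapB N opprK.
Qed.

End Map.

(* The quasicoherent module S |-> S \otimes_R M. *)
Definition qcoh : fmod Left R.
Proof.
refine (@Fmod Left R tens_smod tens_map (@tens_mapD) _ _ _).
- move=> S T f a; apply: tens_ext => [x y|x y|s m].
  + by rewrite /= tens_actB tens_mapB.
  + by rewrite /= tens_mapB tens_actB.
  + by rewrite /= tens_actE !tens_mapE tens_actE rmorphM.
- move=> S; apply: tens_ext => [|//|s m]; first exact: tens_mapB.
  by rewrite tens_mapE.
- move=> S T U g f; apply: tens_ext => [|x y|s m]; first exact: tens_mapB.
    by rewrite !tens_mapB.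
  by rewrite !tens_mapE.
Defined.

End Tensor.

(* Main.v *)
Require Import Defs.
From HB Require Import structures.
From mathcomp Require Import all_boot all_algebra.
Set Implicit Arguments.
Unset Strict Implicit.
Unset Printing Implicit Defensive.
Import GRing.Theory.
Local Open Scope ring_scope.

(** The dual of the quasicoherent module of M has at T the group Hom_R(M, T) of
    R-linear maps, so an element phi of the bidual over S is a family of maps
    Hom_R(M, T) -> T, natural in the S-algebra T and right T-linear.  Put
    N = S (x)_R M; every R-linear u : M -> T extends to a left S-linear map
    N -> T, and we look for z in N such that phi_T u is the value of this
    extension at z, for all T and u.

    Naturality alone gives an element of N (x)_Z S.  Let B be the square-zero
    extension of S by the bimodule N (x)_Z S, and let coef be the square-zero
    component of phi at the tautological map M -> B, m |-> (1 (x) m) (x) 1.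
    Given u : M -> T, the ring map from B to the dual numbers T[eps] that sends
    n (x) s to u(n) s eps carries the tautological map to u eps.  As phi_T[eps]
    of u eps is (phi_T u) eps by linearity, comparing coefficients of eps yields
    phi_T u = sum_i u(n_i) s_i when coef = sum_i n_i (x) s_i (bidual_coef).

    Linearity forces coef to lie in N (x) 1.  Adjoin to S a variable t that does
    not commute with S and satisfies t S t = 0: this is the square-zero extension
    A of S by S (x)_Z S, with t = 1 (x) 1.  The same construction over A, with A
    acting on N through t = 0, gives an algebra in which
    phi (u t) = (phi u) t, for u the tautological map, reads
    sum_i n_i (x) t s_i = sum_i n_i (x) s_i t in N (x)_Z A.  The group morphism
    N (x)_Z A -> N (x)_Z S that sends n (x) a t b to a n (x) b turns this into
    coef = z (x) 1 with z = sum_i s_i n_i (coef_descent).  Hence phi_T u is the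
    value at z of the extension of u, that is, phi is evaluation at z.  The last
    group morphism exists because the tensor product is taken over the integers;
    it is not a morphism of bimodules.

    Conversely, when phi is evaluation at z, its coef is z (x) 1, so that
    sum_i s_i n_i recovers z. *)

(** * Additive maps and isomorphisms of functors *)

Lemma morphBD (U V : zmodType) (g : U -> V) :
  {morph g : x y / x - y} -> {morph g : x y / x + y}.
Proof.
move=> gB; exact: (raddfD (HB.pack_for {additive U -> V} g
  (GRing.isZmodMorphism.Build U V g gB))).
Qed.

Section AdditiveOf.
Variables (U V : zmodType) (g : U -> V).
Hypothesis gD : {morph g : x y / x + y}.

Fact additive_of_zmod : zmod_morphism g.
Proof.
have g0 : g 0 = 0 by apply: (@addrI _ (g 0)); rewrite -gD !addr0.
move=> x y; rewrite gD; congr (_ + _); apply: (@addrI _ (g y)).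
by rewrite -gD !subrr.
Qed.

Definition additive_of : {additive U -> V} :=
  HB.pack_for {additive U -> V} g
    (GRing.isZmodMorphism.Build U V g additive_of_zmod).

End AdditiveOf.

(** Additivity, linearity and naturality of the inverse come for free from those
    of f, since f is injective. *)
Lemma is_iso_can (sd : side) (R : pzRingType) (M N : fmod sd R) (f : fhom M N)
    (g : forall S : ralg R, N S -> M S) :
  (forall S, cancel (f S) (g S)) -> (forall S, cancel (g S) (f S)) -> is_iso f.
Proof.
move=> fK gK.
have gD S : {morph g S : x y / sadd x y}.
  by move=> x y; apply: (can_inj (fK S)); rewrite fhomD !gK.
have gZ (S : ralg R) (a : S) (x : N S) : g S (sact a x) = sact a (g S x).
  by apply: (can_inj (fK S)); rewrite fhomZ !gK.
have g_nat (S T : ralg R) (h : ralg_hom S T) (x : N S) :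
    g T (fmap N h x) = fmap M h (g S x).
  by apply: (can_inj (fK T)); rewrite fhom_nat !gK.
exists (@Fhom sd R N M g gD gZ g_nat).
by split; apply: fhom_eq => S x /=; rewrite ?fK ?gK.
Qed.

(** * Tensor products over the integers *)

Section IntegralTensor.
Variables (N : zmodType) (A : pzRingType).

Definition biadditive (V : zmodType) (f : N -> A -> V) :=
  (forall a, {morph f^~ a : x y / x + y}) /\
  (forall x, {morph f x : a b / a + b}).

Definition int_alg : ralg int := @Ralg int A intr.

Definition ztens : zmodType := tens (zmodule N) int_alg.

Definition ztmul (x : N) (a : A) : ztens :=
  tmul (S := int_alg) a (x : zmodule N).

Lemma ztmulDl a : {morph ztmul^~ a : x y / x + y}.
Proof. by move=> x y; apply: tmulDr. Qed.

Lemma ztmulDr x : {morph ztmul x : a b / a + b}.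
Proof. by move=> a b; apply: tmulDl. Qed.

Lemma ztmulBl a : {morph ztmul^~ a : x y / x - y}.
Proof. exact: (raddfB (additive_of (ztmulDl a))). Qed.

Section Lift.
Variables (V : zmodType) (f : N -> A -> V).
Hypothesis fP : biadditive f.

Fact biadditive_balanced (a : int_alg) (k : int) (x : zmodule N) :
  f x (a * ralg_str int_alg k) = f (k *: x) a.
Proof.
have [fDl fDr] := fP; have -> : k *: x = (x : N) *~ k :> N by [].
have /= -> := raddfMz (additive_of (fDl a)) k x.
have /= <- := raddfMz (additive_of (fDr x)) k a.
by congr (f x _); apply: mulrzr.
Qed.

Let lift : ztens -> V := @tens_lift _ (zmodule N) int_alg V (fun a x => f x a).

Fact ztens_lift_zmod : zmod_morphism lift.
Proof.
exact: (@tens_liftB _ (zmodule N) int_alg V (fun a x => f x a)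
  (fun a b x => fP.2 x a b) fP.1 biadditive_balanced).
Qed.

Definition ztens_lift : {additive ztens -> V} :=
  HB.pack_for {additive ztens -> V} lift
    (GRing.isZmodMorphism.Build ztens V lift ztens_lift_zmod).

Lemma ztens_liftE x a : ztens_lift (ztmul x a) = f x a.
Proof.
exact: (@tens_liftE _ (zmodule N) int_alg V (fun a x => f x a)
  (fun a b x => fP.2 x a b) fP.1 biadditive_balanced).
Qed.

End Lift.

Lemma ztens_ext (V : zmodType) (f g : ztens -> V) :
  {morph f : x y / x - y} -> {morph g : x y / x - y} ->
  (forall x a, f (ztmul x a) = g (ztmul x a)) -> f =1 g.
Proof. by move=> fB gB fg; apply: tens_ext => // a x; apply: fg. Qed.

End IntegralTensor.

(** * Square-zero extensions of a ring by a bimodule *)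

Record bimod (A : pzRingType) := Bimod {
  bimod_car :> zmodType;
  lact : A -> bimod_car -> bimod_car;
  ract : bimod_car -> A -> bimod_car;
  lactDl : forall p, {morph lact^~ p : a b / a + b};
  lactDr : forall a, {morph lact a : p q / p + q};
  lact1 : forall p, lact 1 p = p;
  lactM : forall a b p, lact (a * b) p = lact a (lact b p);
  ractDl : forall a, {morph ract^~ a : p q / p + q};
  ractDr : forall p, {morph ract p : a b / a + b};
  ract1 : forall p, ract p 1 = p;
  ractM : forall a b p, ract p (a * b) = ract (ract p a) b;
  lractA : forall a p b, ract (lact a p) b = lact a (ract p b) }.

Definition regular_bimod (A : pzRingType) : bimod A :=
  @Bimod A A *%R *%R (fun p a b => mulrDl a b p) (@mulrDr A) (@mul1r A)
    (fun a b p => esym (mulrA a b p)) (fun p a b => mulrDl a b p) (@mulrDr A)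
    (@mulr1 A) (fun a b p => mulrA p a b) (fun a p b => esym (mulrA a p b)).

Definition trivext (A : pzRingType) (P : bimod A) : Type := (A * P)%type.

Section TrivialExtension.
Variables (A : pzRingType) (P : bimod A).

HB.instance Definition _ := GRing.Zmodule.copy (trivext P) (A * P)%type.

Lemma lact0r (a : A) : lact a 0 = 0 :> P.
Proof. exact: (raddf0 (additive_of (@lactDr _ P a))). Qed.

Lemma ract0l (a : A) : ract 0 a = 0 :> P.
Proof. exact: (raddf0 (additive_of (@ractDl _ P a))). Qed.

Lemma lact0l (p : P) : lact 0 p = 0.
Proof. exact: (raddf0 (additive_of (lactDl p))). Qed.

Lemma ract0r (p : P) : ract p 0 = 0.
Proof. exact: (raddf0 (additive_of (ractDr p))). Qed.

Definition trivext_op (x y : trivext P) : trivext P :=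
  (x.1 * y.1, lact x.1 y.2 + ract x.2 y.1).

Fact trivext_mulA : associative trivext_op.
Proof.
move=> [a p] [b q] [c r]; rewrite /trivext_op /= mulrA; congr pair.
by rewrite lactDr ractDl lactM ractM lractA addrA.
Qed.

Fact trivext_mul1l : left_id ((1, 0) : trivext P) trivext_op.
Proof. by move=> [a p]; rewrite /trivext_op /= mul1r lact1 ract0l addr0. Qed.

Fact trivext_mul1r : right_id ((1, 0) : trivext P) trivext_op.
Proof. by move=> [a p]; rewrite /trivext_op /= mulr1 ract1 lact0r add0r. Qed.

Fact trivext_mulDl : left_distributive trivext_op +%R.
Proof.
move=> [a p] [b q] [c r]; congr pair; first exact: mulrDl.
by rewrite /= lactDl ractDl addrACA.
Qed.

Fact trivext_mulDr : right_distributive trivext_op +%R.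
Proof.
move=> [a p] [b q] [c r]; congr pair; first exact: mulrDr.
by rewrite /= lactDr ractDr addrACA.
Qed.

HB.instance Definition _ := GRing.Zmodule_isPzRing.Build (trivext P)
  trivext_mulA trivext_mul1l trivext_mul1r trivext_mulDl trivext_mulDr.

Definition trivext_fst (x : trivext P) : A := x.1.
HB.instance Definition _ :=
  GRing.isZmodMorphism.Build (trivext P) A trivext_fst (fun x y => erefl).
HB.instance Definition _ :=
  GRing.isMonoidMorphism.Build (trivext P) A trivext_fst
    (erefl, fun x y => erefl).

Definition trivext_snd (x : trivext P) : P := x.2.
HB.instance Definition _ :=
  GRing.isZmodMorphism.Build (trivext P) P trivext_snd (fun x y => erefl).

Definition trivext_inl (a : A) : trivext P := (a, 0).

Fact trivext_inl_zmod : zmod_morphism trivext_inl.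
Proof. by move=> a b; congr pair; rewrite /= subrr. Qed.

Fact trivext_inl_monoid : monoid_morphism trivext_inl.
Proof. by split=> // a b; congr pair; rewrite /= lact0r ract0l addr0. Qed.

HB.instance Definition _ :=
  GRing.isZmodMorphism.Build A (trivext P) trivext_inl trivext_inl_zmod.
HB.instance Definition _ :=
  GRing.isMonoidMorphism.Build A (trivext P) trivext_inl trivext_inl_monoid.

Definition trivext_inr (p : P) : trivext P := (0, p).

Fact trivext_inr_zmod : zmod_morphism trivext_inr.
Proof. by move=> p q; congr pair; rewrite /= subrr. Qed.

HB.instance Definition _ :=
  GRing.isZmodMorphism.Build P (trivext P) trivext_inr trivext_inr_zmod.

Lemma trivext_mul_inlr a p :
  trivext_inl a * trivext_inr p = trivext_inr (lact a p).
Proof. by congr pair; rewrite /= ?mulr0 // ract0l addr0. Qed.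

Lemma trivext_mul_inrl a p :
  trivext_inr p * trivext_inl a = trivext_inr (ract p a).
Proof. by congr pair; rewrite /= ?mul0r // lact0l add0r. Qed.

End TrivialExtension.

Arguments trivext_inr {A} P p.

Section TrivialExtensionMap.
Variables (A B : pzRingType) (P : bimod A) (Q : bimod B).
Variables (f : {rmorphism A -> B}) (g : {additive P -> Q}).
Hypothesis g_lact : forall a p, g (lact a p) = lact (f a) (g p).
Hypothesis g_ract : forall p a, g (ract p a) = ract (g p) (f a).

Let map (x : trivext P) : trivext Q := (f x.1, g x.2).

Fact trivext_map_zmod : zmod_morphism map.
Proof. by move=> x y; congr pair; apply: raddfB. Qed.

Fact trivext_map_monoid : monoid_morphism map.
Proof.
split=> [|x y]; congr pair; rewrite /= ?rmorph1 ?raddf0 ?rmorphM //.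
by rewrite raddfD g_lact g_ract.
Qed.

Definition trivext_map : {rmorphism trivext P -> trivext Q} :=
  HB.pack_for {rmorphism trivext P -> trivext Q} map
    (GRing.isZmodMorphism.Build _ _ _ trivext_map_zmod)
    (GRing.isMonoidMorphism.Build _ _ _ trivext_map_monoid).

End TrivialExtensionMap.

(** * The bimodule N (x)_Z A *)

Section TensorBimodule.
Variables (A S : pzRingType) (pi : {rmorphism A -> S}) (N : lmodType S).
Local Notation NA := (ztens N A).

Fact ztens_lact_biadd a :
  biadditive (fun (x : N) (b : A) => ztmul (pi a *: x) b).
Proof. by split=> [b x y|x b c] /=; rewrite (scalerDr, ztmulDr) ?ztmulDl. Qed.

Fact ztens_ract_biadd a : biadditive (fun (x : N) (b : A) => ztmul x (b * a)).
Proof. by split=> [b x y|x b c] /=; rewrite ?mulrDl (ztmulDl, ztmulDr). Qed.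

Definition ztens_lact a : {additive NA -> NA} :=
  ztens_lift (ztens_lact_biadd a).
Definition ztens_ract a : {additive NA -> NA} :=
  ztens_lift (ztens_ract_biadd a).

Lemma ztens_lactE a x b : ztens_lact a (ztmul x b) = ztmul (pi a *: x) b.
Proof. exact: ztens_liftE. Qed.

Lemma ztens_ractE a x b : ztens_ract a (ztmul x b) = ztmul x (b * a).
Proof. exact: ztens_liftE. Qed.

(** The map pi is there because the same N, a module over S, is used with A = S
    and with a larger algebra A that retracts onto S. *)
Definition ztens_bimod : bimod A.
Proof.
refine (@Bimod A NA ztens_lact (fun p a => ztens_ract a p) _ _ _ _ _ _ _ _ _).
- move=> p a b.
  apply: (ztens_ext (g := fun p => ztens_lact a p + ztens_lact b p)) p.
  + exact: raddfB.
  + by move=> p q; rewrite !raddfB opprD addrACA.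
  + by move=> x c; rewrite !ztens_lactE rmorphD scalerDl ztmulDl.
- by move=> a; apply: raddfD.
- apply: ztens_ext => [|//|x b]; first exact: raddfB.
  by rewrite ztens_lactE rmorph1 scale1r.
- move=> a b; apply: ztens_ext => [|p q|x c]; first exact: raddfB.
    by rewrite !raddfB.
  by rewrite !ztens_lactE rmorphM scalerA.
- by move=> a; apply: raddfD.
- move=> p a b.
  apply: (ztens_ext (g := fun p => ztens_ract a p + ztens_ract b p)) p.
  + exact: raddfB.
  + by move=> p q; rewrite !raddfB opprD addrACA.
  + by move=> x c; rewrite !ztens_ractE mulrDr ztmulDr.
- apply: ztens_ext => [|//|x b]; first exact: raddfB.
  by rewrite ztens_ractE mulr1.
- move=> a b; apply: ztens_ext => [|p q|x c]; first exact: raddfB.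
    by rewrite !raddfB.
  by rewrite !ztens_ractE mulrA.
- move=> a p b; move: p.
  apply: ztens_ext => [p q|p q|x c]; rewrite ?raddfB //.
  by rewrite !(ztens_lactE, ztens_ractE).
Defined.

Lemma lact_ztmul a x b :
  lact a (ztmul x b : ztens_bimod) = ztmul (pi a *: x) b.
Proof. exact: ztens_lactE. Qed.

Lemma ract_ztmul x b a :
  ract (ztmul x b : ztens_bimod) a = ztmul x (b * a).
Proof. exact: ztens_ractE. Qed.

End TensorBimodule.

(** * The dual of a quasicoherent module *)

Section DualOfQcoh.
Variables (R : pzRingType) (M : lmodType R).

Definition str_linear (S : ralg R) (u : M -> S) :=
  {morph u : x y / x + y} /\ (forall r x, u (r *: x) = ralg_str S r * u x).

(** The dual at S is Hom_R(M, S): by S-linearity and naturality an element is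
    determined by its values at the 1 (x) x over S itself.  The inverse bijection
    is dual_of. *)
Definition dual_val (S : ralg R) (w : dual (qcoh M) S) (x : M) : S :=
  w (self_alg S) (tmul (S := res (self_alg S)) 1 x).

Lemma dual_valE (S : ralg R) (w : dual (qcoh M) S) (T : ralg S) (t : T) (x : M) :
  w T (tmul (S := res T) t x) = t * ralg_str T (dual_val w x).
Proof.
have -> : tmul (S := res T) t x
    = sact t (tmul (S := res T) 1 x :> qcoh M (res T)).
  by rewrite /= tens_actE mulr1.
rewrite (fhomZ w) /=; congr (_ * _).
(* The structure map S -> T is a morphism of S-algebras; naturality of w along
   it computes w_T at 1 (x) x. *)
have f_str s : (ralg_str T : {rmorphism S -> T}) (ralg_str (self_alg S) s)
  = ralg_str T s by [].
have /= <- := fhom_nat w (RalgHom _ f_str) (tmul (S := res (self_alg S)) 1 x).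
by rewrite tens_mapE rmorph1.
Qed.

Lemma dual_appB (S : ralg R) (w : dual (qcoh M) S) (T : ralg S) :
  {morph w T : x y / (x - y : tens M (res T)) >-> x - y}.
Proof. exact: (raddfB (additive_of (fhomD w (S := T)))). Qed.

Lemma dual_ext (S : ralg R) (w v : dual (qcoh M) S) :
  dual_val w =1 dual_val v -> w = v.
Proof.
move=> wv; apply: fhom_eq => T; apply: tens_ext => [||t x].
- exact: dual_appB.
- exact: dual_appB.
- by rewrite !dual_valE wv.
Qed.

Lemma dual_val_act (S : ralg R) (a : S) (w : dual (qcoh M) S) x :
  dual_val (sact a w) x = dual_val w x * a.
Proof. by []. Qed.

Lemma dual_val_fmap (S T : ralg R) (h : ralg_hom S T) (w : dual (qcoh M) S) x :
  dual_val (fmap (dual (qcoh M)) h w) x = h (dual_val w x).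
Proof.
rewrite [LHS]/dual_val /= tens_mapE.
by apply: etrans (dual_valE w (T := pull h (self_alg T)) 1 x) _; rewrite mul1r.
Qed.

Section OfLinear.
Variables (S : ralg R) (u : M -> S).
Hypothesis uP : str_linear u.

Section Value.
Variable T : ralg S.
Let v (t : res T) (x : M) : T := t * ralg_str T (u x).

Fact dual_ofDl s s' x : v (s + s') x = v s x + v s' x.
Proof. exact: mulrDl. Qed.

Fact dual_ofDr s x y : v s (x + y) = v s x + v s y.
Proof. by rewrite /v uP.1 rmorphD mulrDr. Qed.

Fact dual_ofZ s r x : v (s * ralg_str (res T) r) x = v s (r *: x).
Proof. by rewrite /v uP.2 rmorphM mulrA. Qed.

Definition dual_of_app : tens M (res T) -> T := tens_lift v.

Lemma dual_of_appE t x : dual_of_app (tmul t x) = t * ralg_str T (u x).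
Proof. exact: (tens_liftE dual_ofDl dual_ofDr dual_ofZ). Qed.

Lemma dual_of_appB : {morph dual_of_app : x y / x - y}.
Proof. exact: (tens_liftB dual_ofDl dual_ofDr dual_ofZ). Qed.

End Value.

Definition dual_of : dual (qcoh M) S.
Proof.
refine (@Fhom Left S (restr (qcoh M) S) (fmod_self Left S) dual_of_app _ _ _).
- by move=> T; apply: (morphBD (@dual_of_appB T)).
- move=> T a; apply: tens_ext => [x y|x y|t x] /=.
  + by rewrite tens_actB dual_of_appB.
  + by rewrite dual_of_appB mulrBr.
  + by rewrite tens_actE !dual_of_appE mulrA.
- move=> T U f; apply: tens_ext => [x y|x y|t x] /=.
  + by rewrite tens_mapB dual_of_appB.
  + by rewrite dual_of_appB rmorphB.
  + by rewrite tens_mapE !dual_of_appE rmorphM ralg_map_str.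
Defined.

Lemma dual_ofK x : dual_val dual_of x = u x.
Proof. by rewrite /dual_val /= dual_of_appE mul1r. Qed.

End OfLinear.

Definition tens_lmod (S : ralg R) : lmodType S :=
  HB.pack_for (lmodType S) (tens M S : Type) (tens M S)
   (@GRing.Zmodule_isLmodule.Build S (tens M S) (@tens_act R M S)
    (fun a b p => esym (@sactM _ _ (tens_smod M S) a b p))
    (@sact1 _ _ (tens_smod M S)) (@tens_actD R M S)
    (fun p a b => @sactDl _ _ (tens_smod M S) a b p)).

Section Evaluation.
Variable S : ralg R.

Lemma bidual_evalE (s : S) (x : M) (T : ralg S) (w : dual (qcoh M) (res T)) :
  bidual_eval (qcoh M) S (tmul s x) T w = ralg_str T s * dual_val w x.
Proof.
rewrite /= tens_mapE.
exact: (dual_valE w (T := self_alg (res T))).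
Qed.

Lemma bidual_evalB (T : ralg S) (w : dual (qcoh M) (res T)) :
  {morph (fun z : tens_lmod S => bidual_eval (qcoh M) S z T w) : x y / x - y}.
Proof.
move=> x y; have /= -> := @tens_mapB _ M _ _ (to_self T) x y.
exact: (dual_appB w (T := self_alg (res T))).
Qed.

Lemma bidual_evalZ (T : ralg S) (w : dual (qcoh M) (res T)) (a : S)
    (z : tens_lmod S) :
  bidual_eval (qcoh M) S (a *: z) T w
    = ralg_str T a * bidual_eval (qcoh M) S z T w.
Proof.
have := fhomZ (bidual_eval (qcoh M)) a (z : qcoh M S).
by move/(congr1 (fun f : dual (dual (qcoh M)) S => f T w)).
Qed.

End Evaluation.

End DualOfQcoh.

(** * Test algebras *)

Section TestAlgebra.
Variables (R : pzRingType) (M : lmodType R) (S : ralg R).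
Variables (A : ralg S) (pi : {rmorphism A -> S}).
Hypothesis piK : cancel (ralg_str A) pi.
Local Notation N := (tens_lmod M S).
Local Notation P := (ztens_bimod pi N).

Definition test_alg : ralg S := Ralg (trivext_inl P \o ralg_str A).

Definition test_val (x : M) : res test_alg :=
  trivext_inr P (ztmul (tmul 1 x : N) 1).

Fact test_val_linear : str_linear test_val.
Proof.
split=> [x y|r x]; rewrite /test_val.
  by rewrite tmulDr ztmulDl; apply: raddfD.
rewrite [RHS]trivext_mul_inlr lact_ztmul piK.
congr (trivext_inr P (@ztmul N A _ _)); rewrite -tmulZ mul1r.
by rewrite [RHS]tens_actE mulr1.
Qed.

(** For A = S this is the universal element that phi is applied to: test_val is
    the R-linear map from M that generates the square-zero ideal as a bimodule. *)
Definition test_dual : dual (qcoh M) (res test_alg) := dual_of test_val_linear.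

(** So z can be read off from its evaluation, which gives the injectivity half of
    the theorem; the same formula computes pairings with test_dual. *)
Lemma bidual_eval_test (z : N) :
  bidual_eval (qcoh M) S z test_alg test_dual = trivext_inr P (ztmul z 1).
Proof.
move: z; apply: tens_ext => [x y|x y|s x].
- exact: (bidual_evalB test_dual x y).
- by have -> := @ztmulBl N A 1 x y; apply: (raddfB (trivext_inr P)).
- rewrite bidual_evalE dual_ofK [LHS]trivext_mul_inlr lact_ztmul piK.
  by rewrite [_ *: _]tens_actE mulr1.
Qed.

End TestAlgebra.

Section NoncommutingVariable.
Variables (R : pzRingType) (S : ralg R).

Definition double_bimod : bimod S := ztens_bimod idfun (S^o : lmodType S).

(** The S-algebra generated by one element t with t S t = 0, which is not
    required to commute with S. *)
Definition ncdual_alg : ralg S := Ralg (trivext_inl double_bimod).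

Definition ncdual_aug : {rmorphism ncdual_alg -> S} :=
  trivext_fst (P := double_bimod).

Lemma ncdual_augK : cancel (ralg_str ncdual_alg) ncdual_aug.
Proof. by []. Qed.

Definition ncvar : ncdual_alg := trivext_inr double_bimod (ztmul (1 : S^o) 1).

Lemma ncvar_mull s :
  ralg_str ncdual_alg s * ncvar = trivext_inr double_bimod (ztmul (s : S^o) 1).
Proof. by rewrite [LHS]trivext_mul_inlr lact_ztmul [_ *: _]mulr1. Qed.

Lemma ncvar_mulr s :
  ncvar * ralg_str ncdual_alg s = trivext_inr double_bimod (ztmul (1 : S^o) s).
Proof. by rewrite [LHS]trivext_mul_inrl ract_ztmul mul1r. Qed.

Variable N : lmodType S.
Local Notation NS := (ztens N S).

Fact double_act_biadd (n : N) :
  biadditive (fun (a : S^o) (b : S) => ztmul ((a : S) *: n) b : NS).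
Proof.
split=> [b x y|a x y] /=; last exact: ztmulDr.
by rewrite scalerDl ztmulDl.
Qed.

Let double_act n := ztens_lift (double_act_biadd n).

Fact ncdual_coef_biadd :
  biadditive (fun (n : N) (x : ncdual_alg) => double_act n x.2).
Proof.
split=> [a x y|n a b]; last exact: (raddfD (double_act n) a.2 b.2).
apply: (ztens_ext (f := double_act (x + y))
  (g := fun p => double_act x p + double_act y p)).
- exact: raddfB.
- by move=> p q; rewrite !raddfB opprD addrACA.
- by move=> c d; rewrite !ztens_liftE scalerDr ztmulDl.
Qed.

(** The coefficient of t, with what stands on the left of t moved onto N:
    n (x) a t b goes to a n (x) b. *)
Definition ncdual_coef : {additive ztens N ncdual_alg -> NS} :=
  ztens_lift ncdual_coef_biadd.

Lemma ncdual_coefE n a b :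
  ncdual_coef (ztmul n (trivext_inr double_bimod (ztmul (a : S^o) b)))
    = ztmul ((a : S) *: n) b.
Proof. by rewrite [LHS]ztens_liftE [LHS]ztens_liftE. Qed.

End NoncommutingVariable.

(** * Reflexivity *)

Section Reflexivity.
Variables (R : pzRingType) (M : lmodType R) (S : ralg R).
Local Notation N := (tens_lmod M S).
Local Notation NS := (ztens N S).
Local Notation P := (ztens_bimod idfun N).
Local Notation ev := (bidual_eval (qcoh M) S).

Section Pairing.
Variables (T : ralg S) (w : dual (qcoh M) (res T)).

Fact pairing_biadd : biadditive (fun (z : N) s => ev z T w * ralg_str T s).
Proof.
split=> [s x y|z s s'] /=; last by rewrite rmorphD mulrDr.
by rewrite -mulrDl; congr (_ * _); apply: (morphBD (bidual_evalB w)).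
Qed.

Definition pairing : {additive NS -> T} := ztens_lift pairing_biadd.

Lemma pairingE z s : pairing (ztmul z s) = ev z T w * ralg_str T s.
Proof. exact: ztens_liftE. Qed.

Lemma pairing_lact (a : S) (p : P) :
  pairing (lact a p) = ralg_str T a * pairing p.
Proof.
move: p; apply: (ztens_ext (f := pairing \o ztens_lact idfun N a)) => [||z s].
- exact: raddfB.
- by move=> p q; rewrite raddfB mulrBr.
- by rewrite /comp ztens_lactE !pairingE bidual_evalZ mulrA.
Qed.

Lemma pairing_ract (p : P) (a : S) :
  pairing (ract p a) = pairing p * ralg_str T a.
Proof.
move: p; apply: (ztens_ext (f := pairing \o ztens_ract N a)) => [||z s].
- exact: raddfB.
- by move=> p q; rewrite raddfB mulrBl.
- by rewrite /comp ztens_ractE !pairingE rmorphM mulrA.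
Qed.

End Pairing.

Fact smult_biadd : biadditive (fun (z : N) (s : S) => s *: z).
Proof. by split=> [s|z] x y; [apply: scalerDr | apply: scalerDl]. Qed.

Definition smult : {additive NS -> N} := ztens_lift smult_biadd.

Lemma smultE z s : smult (ztmul z s) = s *: z.
Proof. exact: ztens_liftE. Qed.

Definition univ_alg : ralg S := test_alg M (A := self_alg S) idfun.

Definition univ_dual : dual (qcoh M) (res univ_alg) :=
  @test_dual _ M S (self_alg S) idfun (fun=> erefl).

Section Coefficient.
Variable phi : dual (dual (qcoh M)) S.

Lemma bidual_act (T : ralg S) (a : T) (w : dual (qcoh M) (res T)) :
  phi T (sact a w) = phi T w * a.
Proof. exact: (fhomZ phi). Qed.

Lemma bidual_nat (T U : ralg S) (f : ralg_hom T U) (w : dual (qcoh M) (res T)) :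
  phi U (fmap (dual (qcoh M)) (res_hom f) w) = f (phi T w).
Proof. exact: (fhom_nat phi). Qed.

Definition coef : NS := trivext_snd (phi univ_alg univ_dual).

(** Any w over T becomes, after multiplication by the central square-zero eps of
    the dual numbers T[eps], the image of univ_dual under a ring morphism.
    Without eps there would be no such morphism, as the values of w need not
    multiply to zero. *)
Lemma bidual_coef (T : ralg S) (w : dual (qcoh M) (res T)) :
  phi T w = pairing w coef.
Proof.
pose Q := regular_bimod T.
pose Teps : ralg S := Ralg (trivext_inl Q \o ralg_str T).
pose iota : ralg_hom T Teps := @RalgHom _ T Teps (trivext_inl Q) (fun=> erefl).
pose eps : Teps := trivext_inr Q 1.
pose g := trivext_map (P := P) (Q := Q) (pairing_lact w) (pairing_ract w).
have g_str s : g (ralg_str univ_alg s) = ralg_str Teps s.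
  by congr pair; apply: raddf0.
pose gh : ralg_hom univ_alg Teps := @RalgHom S univ_alg Teps g g_str.
have w_eps : sact (eps : res Teps) (fmap (dual (qcoh M)) (res_hom iota) w)
    = fmap (dual (qcoh M)) (res_hom gh) univ_dual.
  apply: dual_ext => x; rewrite dual_val_act !dual_val_fmap dual_ofK.
  rewrite [LHS]trivext_mul_inlr; congr pair; first exact/esym/rmorph0.
  apply: etrans (esym (pairingE w (tmul 1 x : N) 1)).
  by rewrite bidual_evalE !rmorph1 mul1r !mulr1; apply: mulr1.
have := congr1 (phi Teps) w_eps.
rewrite bidual_act !bidual_nat => /(congr1 (@trivext_snd T Q)).
by rewrite [iota _ * eps]trivext_mul_inlr /= mulr1.
Qed.

(** This expresses phi (w t) = phi w * t for the tautological w over the test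
    algebra of ncdual_alg.  By bidual_coef the two sides are the images of coef
    under n (x) s |-> n (x) t s and n (x) s |-> n (x) s t; their images under
    ncdual_coef are n (x) s and s n (x) 1. *)
Lemma coef_descent : coef = ztmul (smult coef) 1.
Proof.
pose T := test_alg M (ncdual_aug S).
pose w : dual (qcoh M) (res T) := test_dual M (@ncdual_augK _ S).
pose Q := ztens_bimod (ncdual_aug S) N.
pose t : T := trivext_inl Q (ncvar S).
pose wt : dual (qcoh M) (res T) := sact (t : res T) w.
pose F (x : T) : NS := ncdual_coef N (@trivext_snd _ Q x).
have FB : {morph F : x y / x - y} by move=> x y; rewrite /F !raddfB.
have Fl : F (pairing wt coef) = coef.
  move: coef; apply: ztens_ext => [p q|//|z s]; first by rewrite raddfB FB.
  have -> : pairing wt (ztmul z s)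
      = trivext_inr Q (ztmul z (ncvar S * ralg_str _ s)).
    rewrite pairingE.
    have -> : ev z T wt = ev z T w * t by [].
    rewrite bidual_eval_test -mulrA -rmorphM.
    by rewrite [LHS]trivext_mul_inrl ract_ztmul mul1r.
  by rewrite ncvar_mulr /F ncdual_coefE scale1r.
have Fr : F (pairing w coef * t) = ztmul (smult coef) 1.
  move: coef; apply: ztens_ext => [p q|p q|z s].
  - by rewrite raddfB mulrBl FB.
  - by rewrite raddfB ztmulBl.
  - have -> : pairing w (ztmul z s) = trivext_inr Q (ztmul z (ralg_str _ s)).
      rewrite pairingE bidual_eval_test.
      by rewrite [LHS]trivext_mul_inrl ract_ztmul mul1r.
    rewrite [_ * t]trivext_mul_inrl ract_ztmul ncvar_mull.
    by rewrite /F ncdual_coefE smultE.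
by rewrite -{1}Fl -Fr -!bidual_coef bidual_act.
Qed.

Lemma bidual_evalK : ev (smult coef) = phi.
Proof.
apply: fhom_eq => T w; rewrite [RHS]bidual_coef [in RHS]coef_descent pairingE.
by rewrite rmorph1 mulr1.
Qed.

End Coefficient.

Lemma coef_bidual_eval z : smult (coef (ev z)) = z.
Proof.
rewrite /coef bidual_eval_test.
by apply: etrans (smultE z 1) _; apply: scale1r.
Qed.

End Reflexivity.

Theorem theorem5p3 (R : pzRingType) (M : lmodType R) :
  is_iso (bidual_eval (qcoh M)).
Proof.
refine (@is_iso_can Left R (qcoh M) (dual (dual (qcoh M))) (bidual_eval (qcoh M))
  (fun S phi => smult M S (coef phi)) _ _) => S.
- exact: coef_bidual_eval.
- exact: bidual_evalK.
Qed.
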